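(* There is an absolute constant $K$ such that for every $n\ge 2$ and every set $\mathcal{L}$ of $n$ grounded L-shapes, it is possible to color every L-shape in $\mathcal{L}$ with one of at most $K\log^2 n$ colors such that for each $\ell\in\mathcal{L}$ that intersects at least one other member of $\mathcal{L}$, among the L-shapes in $\mathcal{L}\setminus\{\ell\}$ whose intersection with $\ell$ is non-empty there is one whose color is different from the colors of all the others among them.
   Context: An L-shape consists of a vertical line-segment and a horizontal line-segment in the plane such that the left endpoint of the horizontal segment coincides with the bottom endpoint of the vertical segment. In a family of L-shapes it is always assumed that no pair of L-shapes have overlapping segments, that is, any two of them have at most one intersection point. A family of L-shapes is grounded if there is a horizontal line that contains the top point of each L-shape in the family. *)

(* Defs.v *)
From HB Require Import structures.
From mathcomp Require Import all_boot all_order all_algebra.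
From mathcomp Require Import all_classical all_reals all_analysis.

Set Implicit Arguments.
Unset Strict Implicit.
Unset Printing Implicit Defensive.

Import Order.TTheory GRing.Theory Num.Theory.

Local Open Scope classical_set_scope.
Local Open Scope ring_scope.

(* Both segments are nondegenerate.  The corner [(lx, ly)] is at once the bottom
   endpoint of the vertical segment and the left endpoint of the horizontal
   one. *)
Record lshape (R : realType) := LShape {
  lx : R;
  ly : R;
  ltop : R;
  lright : R;
  ly_lt_ltop : ly < ltop;
  lx_lt_lright : lx < lright
}.

Section LShapes.
Context {R : realType}.
Implicit Types (l : lshape R) (L : set (lshape R)).

Definition vertical_segment l : set (R * R) := [set lx l] `*` `[ly l, ltop l].

Definition horizontal_segment l : set (R * R) :=
  `[lx l, lright l] `*` [set ly l].

Definition points l : set (R * R) :=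
  vertical_segment l `|` horizontal_segment l.

Definition top_point l : R * R := (lx l, ltop l).

Definition nonoverlapping L : Prop :=
  forall l l', L l -> L l' -> l <> l' -> is_subset1 (points l `&` points l').

Definition grounded L : Prop :=
  exists g : R, forall l, L l -> (top_point l).2 = g.

Definition neighbours L l : set (lshape R) :=
  [set l' | L l' /\ l' <> l /\ points l `&` points l' !=set0].

(* Members of [L] with no neighbour are exempt. *)
Definition conflict_free (C : Type) L (col : lshape R -> C) : Prop :=
  forall l, L l -> neighbours L l !=set0 ->
    exists2 l', neighbours L l l' &
      forall l'', neighbours L l l'' -> l'' <> l' -> col l'' <> col l'.

End LShapes.

(* Main.v *)
Require Import Defs.
From mathcomp Require Import all_boot zify.
Set Implicit Arguments.
Unset Strict Implicit.
Unset Printing Implicit Defensive.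

(** Only the combinatorics of the family matters. Number the L-shapes from left
    to right by [pos]; let [reach a] count the verticals that stand weakly to
    the left of the right end of [a], and let [height] rank the horizontals,
    ties being broken so that the shape further right is the lower one. Then [a]
    meets a shape [b] to its right exactly when [pos b < reach a] and
    [height b < height a] ([crosses a b]).

    Colouring by removal. Suppose that for every vertex set [U] some graph with
    at most [K * #|U|] edges has an edge inside each neighbourhood trace [N v
    :&: U] of size at least 2. A sparse graph has an independent set containing
    a fraction 1/O(K) of the vertices. Give such a set a fresh colour, delete
    it, and repeat: everything is deleted after O(K log n) rounds, and the last
    colour that a neighbourhood receives is received once
    ([colorable_of_sparse]).

    Left and right neighbours taken separately are sparse with a constant K. The
    left neighbours of [v] are the highest among the horizontals that pass over
    [pos v], so the two highest ones at each position form an edge, and this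
    pair changes only when a horizontal starts or ends ([left_sparse]). The
    right neighbours of [v] are the low vertices in an interval, so the highest
    of them is joined to the next low vertex on one of its sides
    ([right_sparse]).

    What is left is a trace made of one left neighbour [i] and one right
    neighbour [j] of [v]. Such pairs can form a complete graph, but not if [v]
    ranges over an independent set [H]. Sort the pairs by the dyadic scale [t]
    at which [pos v] and [pos j] separate. The members of [H] that cross the
    middle of one dyadic block rise from left to right, as otherwise two of them
    would meet; therefore, when [v] moves right, [i] moves right and [j] moves
    left, and such a monotone bipartite graph has a linear number of edges
    ([linking_sparse]). With O(log n) scales this gives K = O(log n), hence a
    colouring of the complement of [H] with O(log^2 n) colours that serves all
    of [H] ([left_right_sparse]).

    The rest must be served by [H], which therefore has to be dominating. Let
    the level of [v] be the dyadic scale of the interval [pos v, reach v[, and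
    build [H] greedily from high levels down, so that each [v] outside [H] has a
    neighbour in [H] of level at least its own ([independent_dominating]). By
    independence, the neighbours of [v] in [H] at one such level are all on the
    same side ([one_sided]), so each level of [H] needs only O(log n) colours,
    and using a separate palette for each level costs O(log^2 n) again. *)

(** * Independent sets in sparse graphs *)

Lemma card_bigcup_le (I T : finType) (A : {set I}) (F : I -> {set T}) :
  #|\bigcup_(i in A) F i| <= \sum_(i in A) #|F i|.
Proof.
elim/big_rec2 : _ => [|i m B _ le]; first by rewrite cards0.
by rewrite (leq_trans (leq_card_setU _ _)) // leq_add2l.
Qed.

(** The edge bounds below all come from naming edges by vertices. *)
Lemma card_le_labels (T P : finType) (U : {set T}) (E : {set P})
    (R : T -> P -> bool) :
  (forall p, p \in E -> exists2 v, v \in U & R v p) ->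
  (forall v p q, p \in E -> q \in E -> R v p -> R v q -> p = q) ->
  #|E| <= #|U|.
Proof.
move=> lab functional.
have EF : E \subset \bigcup_(v in U) [set p in E | R v p].
  apply/subsetP => p pE; have [v vU Rvp] := lab p pE.
  by apply/bigcupP; exists v => //; rewrite inE pE.
apply: leq_trans (subset_leq_card EF) _; apply: leq_trans (card_bigcup_le _ _) _.
rewrite -sum1_card; apply: leq_sum => v _; apply/card_le1_eqP => p q.
by rewrite !inE => /andP[pE Rp] /andP[qE Rq]; apply: (functional v).
Qed.

Definition incident (T : finType) (E : {set T * T}) v :=
  [set p in E | (p.1 == v) || (p.2 == v)].

Lemma sum_card_incident (T : finType) (E : {set T * T}) :
  \sum_v #|incident E v| <= 2 * #|E|.
Proof.
have -> : 2 * #|E| = \sum_v #|[set p in E | p.1 == v]|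
                   + \sum_v #|[set p in E | p.2 == v]|.
  rewrite mul2n -addnn; congr (_ + _).
    rewrite -sum1_card (partition_big fst xpredT) //=.
    by apply: eq_bigr => v _; rewrite -sum1_card; apply: eq_bigl => p; rewrite !inE.
  rewrite -sum1_card (partition_big snd xpredT) //=.
  by apply: eq_bigr => v _; rewrite -sum1_card; apply: eq_bigl => p; rewrite !inE.
rewrite -big_split /=; apply: leq_sum => v _.
rewrite (leq_trans _ (leq_card_setU _ _)) //.
by apply/subset_leq_card/subsetP => p; rewrite !inE; case: (p \in E).
Qed.

(** Loops are harmless: the edges used below join distinct vertices. *)
Definition edge_free (T : finType) (E : {set T * T}) (I : {set T}) :=
  [forall p in E, (p.1 \in I) && (p.2 \in I) ==> (p.1 == p.2)].

(** The average degree is at most [2 * K], so at least half of the vertices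
    have degree at most [4 * K]. A maximal independent set among those dominates
    them, and each of its members dominates at most [4 * K + 1] of them. *)
Lemma large_independent_set (T : finType) (K : nat) (V : {set T})
    (E : {set T * T}) :
  #|E| <= K * #|V| ->
  exists I : {set T},
    [/\ I \subset V, edge_free E I & #|V| <= (8 * K + 2) * #|I|].
Proof.
move=> cardE.
pose W := [set v in V | #|incident E v| <= 4 * K].
have VW : #|V| <= 2 * #|W|.
  have VD : #|V| = #|W| + #|V :\: W|.
    have /setIidPr WV : W \subset V by apply/subsetP => v; rewrite inE => /andP[].
    by rewrite -[in LHS](cardsID W V) WV.
  have : #|V :\: W| * (4 * K).+1 <= 2 * #|E|.
    apply: leq_trans (sum_card_incident E).
    rewrite -sum_nat_const [leqRHS](bigID (mem (V :\: W))) /=.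
    apply: leq_trans (leq_addr _ _); apply: leq_sum => v.
    by rewrite !inE; case: (v \in V) => //=; rewrite ?andbT ?andbF // -ltnNge.
  nia.
pose ok (I : {set T}) := (I \subset W) && edge_free E I.
have ok0 : ok set0.
  by rewrite /ok sub0set; apply/forall_inP => p _; rewrite inE.
have [I /maxsetP[/andP[IW /forall_inP freeI] maxI] _] := maxset_exists ok0.
exists I; split; [|by apply/forall_inP|].
  by apply: subset_trans IW _; apply/subsetP => v; rewrite inE => /andP[].
suff : #|W| <= #|I| + #|I| * (4 * K) by nia.
pose N u := [set w | [exists p in incident E u, (p == (u, w)) || (p == (w, u))]].
have sub : W \subset I :|: \bigcup_(u in I) N u.
  apply/subsetP => w wW; rewrite inE.
  have [//|wI /=] := boolP (w \in I).
  have nok : ~~ ok (w |: I).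
    by apply/negP => /maxI /(_ (subsetUr _ _)) eqI; rewrite -eqI !inE eqxx in wI.
  move: nok; rewrite /ok subUset sub1set wW IW /=.
  case/forall_inPn => -[a b] pE; rewrite negb_imply !inE /= => /andP[/andP[aI bI] ab].
  have /= := freeI _ pE.
  case: (eqVneq a w) aI => [aw _|aw /= aI].
    have {}bI : b \in I.
      by move: bI ab; rewrite aw; case: eqVneq => //= ->; rewrite eqxx.
    move=> _; apply/bigcupP; exists b => //; rewrite inE; apply/exists_inP.
    by exists (a, b); rewrite ?inE ?pE /= ?eqxx ?orbT // aw eqxx orbT.
  case: (eqVneq b w) bI => [bw _ _|bw /= bI].
    apply/bigcupP; exists a => //; rewrite inE; apply/exists_inP.
    by exists (a, b); rewrite ?inE ?pE /= ?eqxx ?orbT // bw eqxx.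
  by rewrite aI bI (negPf ab).
apply: leq_trans (subset_leq_card sub) _.
apply: leq_trans (leq_card_setU _ _) _; rewrite leq_add2l.
apply: leq_trans (card_bigcup_le _ _) _; rewrite -sum_nat_const.
apply: leq_sum => u /(subsetP IW); rewrite inE => /andP[_]; apply: leq_trans.
apply: (@card_le_labels _ _ _ _ (fun p w => (p == (u, w)) || (p == (w, u)))).
  by move=> w; rewrite inE => /exists_inP.
move=> p w w' _ _ /orP[] /eqP -> /orP[] /eqP[]; congruence.
Qed.

(** * Colouring by repeated removal *)

Definition unique_color (T : finType) (A : {set T}) (c : T -> nat) :=
  [exists u in A, forall w in A, (w != u) ==> (c w != c u)].

Definition hits (T : finType) (E : {set T * T}) (A : {set T}) :=
  [exists p in E, [&& p.1 != p.2, p.1 \in A & p.2 \in A]].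

Section ColorByRemoval.
Context (T : finType) (S : Type) (N : S -> {set T}).

Definition colorable (M : nat) (U : {set T}) :=
  exists c : T -> nat, (forall v, v \in U -> c v < M) /\
    forall s, N s :&: U != set0 -> unique_color (N s :&: U) c.

Lemma colorableW M M' U : M <= M' -> colorable M U -> colorable M' U.
Proof.
by move=> le [c [cM uniq]]; exists c; split=> // v /cM /leq_trans; apply.
Qed.

(** The new colour goes to [I]: if [N s] misses [U :\: I], its trace on [U] lies
    in [I] and is a single vertex; otherwise a colour that is unique on the rest
    stays unique. *)
Lemma colorable_remove M (U I : {set T}) : I \subset U ->
  (forall s, 1 < #|N s :&: U| -> ~~ (N s :&: U \subset I)) ->
  colorable M (U :\: I) -> colorable M.+1 U.
Proof.
move=> IU indep [c [cM uniq]].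
exists (fun v => if v \in I then M else c v); split=> [v vU|s ne].
  by case: ifPn => // vI; apply: ltnW; apply: cM; rewrite inE vI.
have [le1|/indep/subsetPn[v]] := leqP #|N s :&: U| 1.
  have [u uA] := set0Pn _ ne; apply/exists_inP; exists u => //.
  apply/forall_inP => w wA; apply/implyP => /eqP wu.
  by case: wu; apply: (card_le1_eqP le1).
rewrite inE => /andP[vN vU] vI.
have /uniq/exists_inP[u] : N s :&: (U :\: I) != set0.
  by apply/set0Pn; exists v; rewrite !inE vN vU vI.
rewrite !inE => /and3P[uN uI uU] /forall_inP uuniq.
apply/exists_inP; exists u; first by rewrite inE uN.
apply/forall_inP => w; rewrite inE => /andP[wN wU]; apply/implyP => wu.
rewrite (negPf uI); case: ifPn => wI.
  by rewrite neq_ltn orbC cM // inE uI.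
by apply: (implyP (uuniq w _)); rewrite // !inE wN wI.
Qed.

(** An independent set of proportion [1 / d] is removed at each step, so [d]
    steps halve the number of remaining vertices. *)
Lemma colorable_of_sparse K (V : {set T}) lam :
  (forall U : {set T}, U \subset V -> exists2 E : {set T * T},
     #|E| <= K * #|U| & forall s, 1 < #|N s :&: U| -> hits E (N s :&: U)) ->
  #|V| < 2 ^ lam -> colorable ((8 * K + 2) * lam) V.
Proof.
move=> sparse; set d := 8 * K + 2.
suff main l (U : {set T}) : U \subset V -> #|U| < 2 ^ l -> colorable (d * l) U.
  exact: main.
elim: l U => [|l IHl] U UV ltU.
  have -> : U = set0 by apply/eqP; rewrite -cards_eq0; lia.
  by exists (fun=> 0); split=> [v|s]; rewrite ?inE // setI0 eqxx.
(* Above the threshold [2 ^ l] each removal takes away at least [2 ^ l / d]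
   vertices, so [d] removals bring a set of size less than [2 ^ l.+1] below it. *)
suff step k (W : {set T}) : W \subset V -> d * #|W| < d * 2 ^ l + k * 2 ^ l ->
    colorable (d * l + k) W.
  by rewrite mulnS addnC; apply: step => //; rewrite expnS in ltU; rewrite /d; nia.
elim: k W => [|k IHk] W WV ltW.
  by rewrite addn0; apply: IHl => //; rewrite /d in ltW *; nia.
have [small|big] := ltnP #|W| (2 ^ l).
  by apply: colorableW (IHl _ WV small); rewrite leq_addr.
have [E cardE hitE] := sparse W WV.
have [I [IW freeI leI]] := large_independent_set cardE.
rewrite addnS; apply: (@colorable_remove _ _ I) => //.
  move=> s /hitE/exists_inP[p pE /and3P[ne p1 p2]]; apply/negP => /subsetP sub.
  move/forall_inP: freeI => /(_ p pE); rewrite (sub _ p1) (sub _ p2) (negPf ne).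
  by [].
apply: IHk; first by apply: subset_trans (subsetDl _ _) WV.
have := cardsID I W; rewrite (setIidPr IW) => cardW.
rewrite -/d in leI; nia.
Qed.
End ColorByRemoval.

(** * Ranks *)

Definition rank (T : finType) (lt : rel T) i := #|[pred j | lt j i]|.

Lemma ltn_rank (T : finType) (lt : rel T) : irreflexive lt -> transitive lt ->
  (forall i j, i != j -> lt i j || lt j i) ->
  forall i j, (rank lt i < rank lt j) = lt i j.
Proof.
move=> irr tr total.
have mono i j : lt i j -> (rank lt i < rank lt j).
  move=> ij; apply/proper_card/properP; split.
    by apply/subsetP => k; rewrite !inE => /tr; apply.
  by exists i; rewrite !inE ?ij ?irr.
move=> i j; apply/idP/idP => [|/mono //]; apply: contraTT => nij.
have [->|/total] := eqVneq i j; first by rewrite ltnn.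
by rewrite (negPf nij) /= -leqNgt => /mono /ltnW.
Qed.

Lemma rank_inj (T : finType) (lt : rel T) : irreflexive lt -> transitive lt ->
  (forall i j, i != j -> lt i j || lt j i) -> injective (rank lt).
Proof.
move=> irr tr total i j e; apply: contraTeq isT => /total.
by rewrite -!(ltn_rank irr tr total) e ltnn.
Qed.

(** * Neighbours on one side *)

Lemma card_setU_sparse (T : finType) (U : {set T}) (E E' : {set T * T}) K K' :
  #|E| <= K * #|U| -> #|E'| <= K' * #|U| -> #|E :|: E'| <= (K + K') * #|U|.
Proof.
by move=> le le'; rewrite (leq_trans (leq_card_setU _ _)) // mulnDl leq_add.
Qed.

Lemma hitsS (T : finType) (E E' : {set T * T}) (A A' : {set T}) :
  E \subset E' -> A \subset A' -> hits E A -> hits E' A'.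
Proof.
move=> /subsetP sE /subsetP sA /exists_inP[p pE /and3P[ne p1 p2]].
by apply/exists_inP; exists p; rewrite ?sE // ne !sA.
Qed.

Section Model.
Context (T : finType) (pos reach height : T -> nat).

Definition crosses a b :=
  [&& pos a < pos b, pos b < reach a & height b < height a].
Definition nbr v := [set u | crosses u v || crosses v u].

Definition active p a := pos a < p < reach a.

Definition top_two (U : {set T}) p (ab : T * T) :=
  [&& ab.1 \in U, ab.2 \in U, active p ab.1, active p ab.2,
      height ab.2 < height ab.1 &
      [forall c in U, active p c ==> (c == ab.1) || (height c <= height ab.2)]].

Definition right_next (U : {set T}) (ab : T * T) :=
  [&& ab.1 \in U, ab.2 \in U, pos ab.1 < pos ab.2, height ab.2 < height ab.1 &
    [forall c in U, (pos ab.1 < pos c < pos ab.2) ==> (height ab.1 <= height c)]].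

Definition left_next (U : {set T}) (ab : T * T) :=
  [&& ab.1 \in U, ab.2 \in U, pos ab.2 < pos ab.1, height ab.2 < height ab.1 &
    [forall c in U, (pos ab.2 < pos c < pos ab.1) ==> (height ab.1 <= height c)]].

Context (pos_inj : injective pos) (height_inj : injective height).

Lemma top_two_inj U p ab cd : top_two U p ab -> top_two U p cd -> ab = cd.
Proof.
case: ab cd => [a b] [c d].
case/and5P=> /= aU bU aA bA /andP[ba /forall_inP abmax].
case/and5P=> /= cU dU cA dA /andP[dc /forall_inP cdmax].
have /predU1P := implyP (abmax c cU) cA; have /predU1P := implyP (cdmax a aU) aA.
have /predU1P := implyP (abmax d dU) dA; have /predU1P := implyP (cdmax b bU) bA.
move=> bcd dab acd cab.
have ac : a = c by case: acd cab => // ? [//|]; lia.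
subst c; congr pair; apply: height_inj.
by case: bcd dab => [eb|?] [ed|?]; try lia; move: ba dc; rewrite ?eb ?ed ltnn.
Qed.

(** The left neighbours of [v] form an upper set, in height, of the active
    vertices at [pos v], so they contain the two highest of these. At the first
    position at which a given pair is on top, either one of the two has just
    started or a horizontal above the lower one has just ended; these are the
    two kinds of labels. *)
Lemma left_sparse (U : {set T}) : exists2 E : {set T * T}, #|E| <= 2 * #|U| &
  forall v, 1 < #|[set a in U | crosses a v]| -> hits E [set a in U | crosses a v].
Proof.
pose F (q : T -> nat) := [set ab | [exists v in U, top_two U (q v) ab]].
have cardF q : #|F q| <= 1 * #|U|.
  rewrite mul1n; apply: (@card_le_labels _ _ _ _ (fun v => top_two U (q v))).
    by move=> ab; rewrite inE => /exists_inP.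
  by move=> v ab cd _ _; apply: top_two_inj.
exists (F (fun v => (pos v).+1) :|: F reach); first exact: (@card_setU_sparse _ _ _ _ 1 1).
move=> v; set A := [set a in U | crosses a v] => /card_gt1P[x [y [xA yA xy]]].
have [a aA amax] := arg_maxnP (P := fun z => z \in A) height xA.
have {}amax c : c \in A -> height c <= height a := amax c.
have [z zA] : exists z, z \in A :\ a.
  have [<-|xa] := eqVneq x a; first by exists y; rewrite in_setD1 eq_sym xy yA.
  by exists x; rewrite in_setD1 xa xA.
have [b bA bmax] := arg_maxnP (P := fun z => z \in A :\ a) height zA.
have {}bmax c : c \in A :\ a -> height c <= height b := bmax c.
have {bA} /andP[ba bA] : (b != a) && (b \in A) by rewrite -in_setD1.
have hba : height b < height a.
  by rewrite ltn_neqAle (inj_eq height_inj) ba amax.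
have ab2 : exists p, top_two U p (a, b).
  exists (pos v); rewrite /top_two /=.
  move: (aA) (bA); rewrite !inE /crosses /active => /and4P[-> -> -> hva] /and4P[-> -> -> hvb].
  rewrite hba /=; apply/forall_inP => c cU; apply/implyP => cact.
  have [//|ca /=] := eqVneq c a; rewrite leqNgt; apply/negP => hbc.
  have : c \in A :\ a.
    by rewrite !inE ca cU /crosses; case/andP: cact => -> ->; rewrite (ltn_trans hvb).
  by move=> /bmax; rewrite leqNgt hbc.
(* The first position at which [a] and [b] are on top. *)
case: (ex_minnP ab2) => p pab pmin.
suff abE : (a, b) \in F (fun v => (pos v).+1) :|: F reach.
  by apply/exists_inP; exists (a, b); rewrite //= eq_sym ba aA bA.
have [aU bU aact bact /andP[_ /forall_inP abtop]] := and5P pab.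
rewrite !inE; rewrite /= in aU bU.
have [pa|pa] := eqVneq p (pos a).+1.
  by apply/orP; left; apply/exists_inP; exists a; rewrite // -pa.
have [pb|pb] := eqVneq p (pos b).+1.
  by apply/orP; left; apply/exists_inP; exists b; rewrite // -pb.
have : ~~ top_two U p.-1 (a, b).
  by apply/negP => /pmin; move: aact; rewrite /active /=; clear; lia.
rewrite /top_two aU bU /= hba /=.
move: aact bact; rewrite /active /= => aact bact.
have -> : pos a < p.-1 < reach a by move: aact pa; clear; lia.
have -> : pos b < p.-1 < reach b by move: bact pb; clear; lia.
case/forall_inPn => c cU; rewrite negb_imply negb_or => /and3P[cact ca cb].
apply/orP; right; apply/exists_inP; exists c => //.
have := abtop c cU; rewrite /active /= (negPf ca) (negPf cb) implybF => ncact.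
have <- : p = reach c by move: ncact cact; clear; lia.
by move: pab; rewrite /top_two /active /= aU bU hba.
Qed.

(** The right neighbours of [v] are the vertices below [v] in an interval of
    positions. If [a] is the highest of at least two of them, the nearest vertex
    of [U] lower than [a], to the left or to the right of [a], is also one. *)
Lemma right_sparse (U : {set T}) : exists2 E : {set T * T}, #|E| <= 2 * #|U| &
  forall v, 1 < #|[set b in U | crosses v b]| -> hits E [set b in U | crosses v b].
Proof.
exists ([set ab | right_next U ab] :|: [set ab | left_next U ab]).
  apply: (@card_setU_sparse _ _ _ _ 1 1); rewrite mul1n;
    apply: (@card_le_labels _ _ _ _ (fun v p => v == p.1)).
  - by move=> [a b]; rewrite inE => /andP[aU _]; exists a.
  - move=> v [a b] [c d]; rewrite !inE.
    case/and5P=> /= aU bU ab hba /forall_inP abnext.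
    case/and5P=> /= cU dU cd hdc /forall_inP cdnext.
    move=> /eqP va /eqP vc; subst a c; congr pair; apply: pos_inj.
    have := abnext d dU; have := cdnext b bU; move: ab hba cd hdc; clear; lia.
  - by move=> [a b]; rewrite inE => /andP[aU _]; exists a.
  - move=> v [a b] [c d]; rewrite !inE.
    case/and5P=> /= aU bU ab hba /forall_inP abnext.
    case/and5P=> /= cU dU cd hdc /forall_inP cdnext.
    move=> /eqP va /eqP vc; subst a c; congr pair; apply: pos_inj.
    have := abnext d dU; have := cdnext b bU; move: ab hba cd hdc; clear; lia.
move=> v; set A := [set b in U | crosses v b] => /card_gt1P[x [y [xA yA xy]]].
have [a aA amax] := arg_maxnP (P := fun z => z \in A) height xA.
have {}amax c : c \in A -> height c <= height a := amax c.
have [z zA za] : exists2 z, z \in A & z != a.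
  have [<-|xa] := eqVneq x a; first by exists y; rewrite // eq_sym.
  by exists x.
have lower b : b \in A -> b != a -> height b < height a.
  by move=> bA ba; rewrite ltn_neqAle (inj_eq height_inj) ba amax.
have inA c b : c \in U -> b \in A ->
    minn (pos a) (pos b) < pos c < maxn (pos a) (pos b) ->
    height c < height a -> c \in A.
  move=> cU; move: aA; rewrite !inE /crosses cU /=; clear; lia.
have : pos z != pos a by rewrite (inj_eq pos_inj).
have aU : a \in U by move: aA; rewrite inE => /andP[].
have AU b : b \in A -> b \in U by rewrite inE => /andP[].
rewrite neq_ltn => /orP[] pza.
  have zP : (z \in A) && (pos z < pos a) by rewrite zA.
  have [b /andP[bA pba] bmax] :=
    arg_maxnP (P := fun z => (z \in A) && (pos z < pos a)) pos zP.
  have {}bmax c : (c \in A) && (pos c < pos a) -> pos c <= pos b := bmax c.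
  have ba : b != a by apply: contraTneq pba => ->; rewrite ltnn.
  apply/exists_inP; exists (a, b); rewrite /= ?aA ?bA ?(eq_sym a) ?ba //.
  rewrite !inE; apply/orP; right; rewrite /left_next /= aU AU // pba lower //=.
  apply/forall_inP => c cU; apply/implyP => pc; rewrite leqNgt; apply/negP => hc.
  have := bmax c; rewrite (inA c b) //; move: pc pba; clear; lia.
have zP : (z \in A) && (pos a < pos z) by rewrite zA.
have [b /andP[bA pba] bmin] :=
  arg_minnP (P := fun z => (z \in A) && (pos a < pos z)) pos zP.
have ba : b != a by apply: contraTneq pba => ->; rewrite ltnn.
apply/exists_inP; exists (a, b); rewrite /= ?aA ?bA ?(eq_sym a) ?ba //.
rewrite !inE; apply/orP; left; rewrite /right_next /= aU AU // pba lower //=.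
apply/forall_inP => c cU; apply/implyP => pc; rewrite leqNgt; apply/negP => hc.
have := bmin c; rewrite (inA c b) //; move: pc pba; clear; lia.
Qed.

(** * Neighbours on both sides of an independent set *)

(** [x] and [y] lie in the left and in the right half of a common dyadic block
    of length [2 ^ t.+1]. *)
Definition separated t x y :=
  (x %/ 2 ^ t.+1 == y %/ 2 ^ t.+1) && (x %/ 2 ^ t < y %/ 2 ^ t).

Lemma separated_exists k x y : x < y -> x %/ 2 ^ k = y %/ 2 ^ k ->
  exists2 t, t < k & separated t x y.
Proof.
move=> xy; elim: k => [|k IHk] eq; first by rewrite expn0 !divn1 in eq; lia.
have [/IHk[t tk sep]|ne] := eqVneq (x %/ 2 ^ k) (y %/ 2 ^ k).
  by exists t; rewrite // ltnW.
exists k => //; rewrite /separated eq eqxx /= ltn_neqAle ne leq_div2r // ltnW //.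
Qed.

Lemma separated_lt t x y x' y' : separated t x y -> separated t x' y' ->
  x %/ 2 ^ t.+1 = x' %/ 2 ^ t.+1 -> x' < y.
Proof.
rewrite /separated expnSr !divnMA.
move=> /andP[/eqP e1 l1] /andP[/eqP e2 l2] e3.
suff lt : x' %/ 2 ^ t < y %/ 2 ^ t.
  by rewrite ltnNge; apply: contraL lt => le; rewrite -leqNgt leq_div2r.
lia.
Qed.

Definition independent (H : {set T}) :=
  forall a b, a \in H -> b \in H -> ~~ crosses a b.

Definition linked (U : {set T}) t v (ij : T * T) :=
  [&& crosses ij.1 v, crosses v ij.2, nbr v :&: U == [set ij.1; ij.2] &
      separated t (pos v) (pos ij.2)].

Definition linking (H U : {set T}) t := [set ij | [exists v in H, linked U t v ij]].

Definition block t v := pos v %/ 2 ^ t.+1.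

Section Linking.
Context (H U : {set T}) (t : nat) (indH : independent H).
Let E := linking H U t.

Lemma linked_memU v ij : linked U t v ij -> ij.1 \in U /\ ij.2 \in U.
Proof.
case/and4P=> _ _ /eqP e _.
have [m1 m2] : ij.1 \in nbr v :&: U /\ ij.2 \in nbr v :&: U.
  by rewrite e !inE !eqxx orbT.
by case/setIP: m1; case/setIP: m2.
Qed.

Lemma linked_left v ij w : linked U t v ij -> w \in U -> crosses w v -> w = ij.1.
Proof.
case/and4P=> c1 c2 /eqP e _ wU wv.
have : w \in nbr v :&: U by rewrite !inE wv wU.
rewrite e !inE => /orP[/eqP //|/eqP we]; subst w.
by move: wv c2; rewrite /crosses; clear; lia.
Qed.

Lemma linked_right v ij w : linked U t v ij -> w \in U -> crosses v w -> w = ij.2.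
Proof.
case/and4P=> c1 c2 /eqP e _ wU wv.
have : w \in nbr v :&: U by rewrite !inE wv wU orbT.
rewrite e !inE => /orP[/eqP we|/eqP //]; subst w.
by move: wv c1; rewrite /crosses; clear; lia.
Qed.

(** Two members of [H] that cross the middle of the same block do not meet, so
    the one further right is higher; hence each left neighbour of the right one
    would also be a left neighbour of the left one unless it stands between
    them, and symmetrically for right neighbours. As the traces on [U] have no
    further vertices, this forces the monotonicity. *)
Lemma linked_mono v v' ij ij' : v \in H -> v' \in H ->
  linked U t v ij -> linked U t v' ij' -> block t ij.2 = block t ij'.2 ->
  pos v < pos v' ->
  (ij.1 = ij'.1 \/ pos v < pos ij'.1) /\ pos ij'.2 <= pos ij.2.
Proof.
move=> vH v'H L L' bl vv'.
have [i'U j'U] := linked_memU L'; have [iU jU] := linked_memU L.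
have [c1 c2 _ s] := and4P L; have [c1' c2' _ s'] := and4P L'.
have v'j : pos v' < pos ij.2.
  apply: (separated_lt s s'); move: s s' bl; rewrite /separated /block.
  by move=> /andP[/eqP -> _] /andP[/eqP -> _].
have hv : height v <= height v'.
  have := indH vH v'H; move: vv' v'j c2; rewrite /crosses; clear; lia.
split.
  have [?|le] := ltnP (pos v) (pos ij'.1); [by right | left].
  apply: esym; apply: (linked_left L) => //.
  have ne : pos ij'.1 != pos v.
    rewrite (inj_eq pos_inj); apply: contraTneq c1' => ->; exact: indH.
  by move: hv vv' le ne c1' c2' c1 c2; rewrite /crosses; clear; lia.
rewrite leqNgt; apply/negP => lt.
have : ij.2 = ij'.2.
  by apply: (linked_right L') => //; move: lt v'j hv c2 c2'; rewrite /crosses; clear; lia.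
by move=> e; rewrite e ltnn in lt.
Qed.

Lemma linked_mono_pos v v' ij ij' : v \in H -> v' \in H ->
  linked U t v ij -> linked U t v' ij' -> block t ij.2 = block t ij'.2 ->
  pos ij.1 < pos ij'.1 -> pos v < pos v'.
Proof.
move=> vH v'H L L' bl ii'; rewrite ltnNge leq_eqVlt; apply/negP => /orP[].
  rewrite (inj_eq pos_inj) => /eqP vv'; subst v'.
  have [i'U _] := linked_memU L'.
  have e : ij'.1 = ij.1 by apply: (linked_left L) => //; case/and4P: L'.
  by rewrite e ltnn in ii'.
move=> v'v; have [[e|lt] _] := linked_mono v'H vH L' L (esym bl) v'v.
  by rewrite e ltnn in ii'.
by case/and4P: L' => + _ _ _; move: lt v'v ii'; rewrite /crosses; clear; lia.
Qed.

(** Within a block, [i] and [j] move in opposite directions. So for a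
    pair [(i, j)], either [i] is the rightmost partner of [j] ([A], named by
    [j]) or [j] is the leftmost partner of [i] in the block ([C], named by [i]).
    As an [i] outside the block could have partners in many blocks, pairs with
    such an [i] form a class [B] of their own, named by [j]: by monotonicity a
    block has at most one [i] of this kind. *)
Lemma linking_sparse : #|E| <= 3 * #|U|.
Proof.
pose A := [set ij in E |
  [forall ij' in E, (ij'.2 == ij.2) ==> (pos ij'.1 <= pos ij.1)]].
pose B := [set ij in E | block t ij.1 != block t ij.2].
pose C := [set ij in E | (block t ij.1 == block t ij.2) &&
  [forall ij' in E, (ij'.1 == ij.1) && (block t ij'.2 == block t ij.2) ==>
     (pos ij.2 <= pos ij'.2)]].
have EP ij : ij \in E -> exists2 v, v \in H & linked U t v ij.
  by rewrite inE => /exists_inP.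
have EU ij : ij \in E -> ij.1 \in U /\ ij.2 \in U.
  by move=> /EP[v _]; apply: linked_memU.
have -> : E = A :|: B :|: C.
  apply/setP => ij; rewrite !in_setU; apply/idP/idP; last first.
    by case/orP=> [/orP[]|]; rewrite inE => /andP[].
  move=> ijE; apply/orP; have [ijC|ijC] := boolP (ij \in C); [by right | left].
  apply/orP; have [ijB|ijB] := boolP (ij \in B); [by right | left].
  have {ijB} /eqP bl : block t ij.1 == block t ij.2.
    by move: ijB; rewrite inE ijE /= negbK.
  move: ijC; rewrite inE ijE bl eqxx /= => /forall_inPn[[i0 j0] ijE0 /=].
  rewrite negb_imply -ltnNge => /andP[/andP[/eqP ? /eqP bl0] lt0]; subst i0.
  rewrite inE ijE /=; apply/forall_inP => -[i1 j1] ijE1 /=.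
  apply/implyP => /eqP ?; subst j1; rewrite leqNgt; apply/negP => lt1.
  have [v vH L] := EP _ ijE.
  have [v0 v0H L0] := EP _ ijE0; have [v1 v1H L1] := EP _ ijE1.
  have v01 := linked_mono_pos v0H v1H L0 L1 bl0 lt1.
  have [_ /=] := linked_mono v0H v1H L0 L1 bl0 v01.
  by rewrite leqNgt lt0.
apply: (@card_setU_sparse _ _ _ _ 2 1); first apply: (@card_setU_sparse _ _ _ _ 1 1); rewrite mul1n.
- apply: (@card_le_labels _ _ _ _ (fun v p => v == p.2)).
    by move=> ij /setIdP[/EU[_ jU] _]; exists ij.2.
  move=> v [i j] [i' j'] /setIdP[ijE /forall_inP imax].
  move=> /setIdP[ijE' /forall_inP imax'] /= /eqP ? /eqP ?; subst j j'.
  have := imax _ ijE'; have := imax' _ ijE; rewrite /= eqxx /= => le ge.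
  by congr pair; apply: pos_inj; move: le ge; clear; lia.
- apply: (@card_le_labels _ _ _ _ (fun v p => v == p.2)).
    by move=> ij /setIdP[/EU[_ jU] _]; exists ij.2.
  have aux ij ij' : ij \in B -> ij' \in B -> ij.2 = ij'.2 ->
      pos ij.1 < pos ij'.1 -> False.
    move=> /setIdP[/EP[v vH L] nb] /setIdP[/EP[v' v'H L'] nb'] ejj ltii.
    have bl : block t ij.2 = block t ij'.2 by rewrite ejj.
    have vv' := linked_mono_pos vH v'H L L' bl ltii.
    have [[e|lt] _] := linked_mono vH v'H L L' bl vv'.
      by rewrite e ltnn in ltii.
    case/negP: nb'; rewrite /block eqn_leq; apply/andP; split.
      by apply: leq_div2r; case/and4P: L'; rewrite /crosses; clear; lia.
    rewrite -ejj; case/and4P: L => _ _ _ /andP[/eqP <- _].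
    by apply: leq_div2r; apply: ltnW.
  move=> v [i j] [i' j'] ijB ijB' /= /eqP ? /eqP ?; subst j j'.
  congr pair; apply: pos_inj; case: (ltngtP (pos i) (pos i')) => // lt.
    by case: (aux _ _ ijB ijB').
  by case: (aux _ _ ijB' ijB).
- apply: (@card_le_labels _ _ _ _ (fun v p => v == p.1)).
    by move=> ij /setIdP[/EU[iU _] _]; exists ij.1.
  move=> v [i j] [i' j'] /setIdP[ijE /andP[/eqP bl /forall_inP jmin]].
  move=> /setIdP[ijE' /andP[/eqP bl' /forall_inP jmin']] /= /eqP ? /eqP ?; subst i i'.
  rewrite /= in bl bl'.
  have := jmin _ ijE'; have := jmin' _ ijE; rewrite /= -bl -bl' eqxx /= => le ge.
  by congr pair; apply: pos_inj; move: le ge; clear; lia.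
Qed.
End Linking.

(** * Levels and the dominating independent set *)

(** By induction on the vertex set: a vertex of least level comes last, and is
    added only if it has no neighbour yet; all earlier levels being at least its
    own, it is dominated as required if it is left out. *)
Lemma independent_dominating (lev : T -> nat) :
  exists2 H : {set T}, independent H &
    forall v, v \notin H -> exists2 u, u \in H & u \in nbr v /\ lev v <= lev u.
Proof.
suff main n (W : {set T}) : #|W| <= n -> exists H : {set T},
    [/\ H \subset W, independent H & forall v, v \in W -> v \notin H ->
      exists2 u, u \in H & u \in nbr v /\ lev v <= lev u].
  have [H [_ indH domH]] := main _ _ (leqnn #|[set: T]|).
  by exists H => // v; apply: domH; rewrite inE.
elim: n W => [|n IHn] W cardW.
  exists set0; split; first exact: sub0set.
    by move=> a b; rewrite inE.
  by move=> v vW; move: cardW; rewrite leqn0 cards_eq0 => /eqP W0; rewrite W0 inE in vW.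
have [->|[x xW]] := set_0Vmem W; first by apply: IHn; rewrite cards0.
have [v vW vmin] := arg_minnP (P := fun z => z \in W) lev xW.
have [|H [HW indH domH]] := IHn (W :\ v).
  by move: cardW; rewrite (cardsD1 v) vW.
have {}HW : H \subset W by apply: subset_trans HW (subsetDl _ _).
have [/exists_inP[u uH uv]|nodom] := boolP [exists u in H, u \in nbr v].
  exists H; split=> // w wW wH; have [->|wv] := eqVneq w v.
    by exists u => //; split=> //; apply: vmin; apply: (subsetP HW).
  by apply: domH => //; rewrite !inE wv.
exists (v |: H); split.
- by rewrite subUset sub1set vW.
- have nov u : u \in H -> ~~ crosses u v /\ ~~ crosses v u.
    move=> uH; apply/andP; rewrite -negb_or; apply: contra nodom => cr.
    by apply/exists_inP; exists u; rewrite // inE.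
  move=> a b /setU1P[->|aH] /setU1P[->|bH].
  + by rewrite /crosses ltnn.
  + by have [] := nov b bH.
  + by have [] := nov a aH.
  + exact: indH.
- move=> w wW; rewrite in_setU1 negb_or => /andP[wv wH].
  have [|u uH uw] := domH w _ wH; first by rewrite !inE wv.
  by exists u => //; rewrite in_setU1 uH orbT.
Qed.

Context (lam : nat) (pos_reach : forall v, pos v < reach v <= 2 ^ lam)
  (card_lam : #|T| < 2 ^ lam).

(** The level of [v] is the least [k] such that one dyadic block of length
    [2 ^ k] contains all of [pos v], ..., [(reach v).-1]. *)
Definition is_level (lev : T -> nat) := forall v,
  [/\ lev v <= lam, pos v %/ 2 ^ lev v = (reach v).-1 %/ 2 ^ lev v &
      forall t, lev v = t.+1 -> separated t (pos v) (reach v).-1].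

Lemma level_exists : exists lev, is_level lev.
Proof.
apply: (@fin_all_exists _ (fun=> nat) (fun v l =>
    [/\ l <= lam, pos v %/ 2 ^ l = (reach v).-1 %/ 2 ^ l &
      forall t, l = t.+1 -> separated t (pos v) (reach v).-1])) => v.
have := pos_reach v => /andP[pr rl].
have top : pos v %/ 2 ^ lam = (reach v).-1 %/ 2 ^ lam by rewrite !divn_small //; lia.
have [e|ne] := eqVneq (pos v) (reach v).-1; first by exists 0; rewrite !expn0 !divn1.
have lt : pos v < (reach v).-1 by lia.
have [t tl sep] := separated_exists lt top; exists t.+1.
by split=> // [|_ [<-] //]; case/andP: sep => /eqP.
Qed.

(** As the level of [v] is at most that of [h] and [h'], all three shapes live
    in one dyadic block of that level. There [h'] starts in the left half, while
    [h], further left and higher, reaches into the right half: they would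
    meet. *)
Lemma one_sided lev (H : {set T}) v h h' : is_level lev -> independent H ->
  h \in H -> h' \in H -> lev h = lev h' -> lev v <= lev h ->
  crosses h v -> crosses v h' -> False.
Proof.
move=> levP indH hH h'H elev lev_v c c'.
have [_ eh seph] := levP h; have [_ eh' seph'] := levP h'; have [_ ev _] := levP v.
have {}ev : pos v %/ 2 ^ lev h = (reach v).-1 %/ 2 ^ lev h.
  by rewrite -(subnKC lev_v) expnD !divnMA ev.
have [hv vh hvh] := and3P c; have [vh' h'v hh'v] := and3P c'.
have bv : pos h %/ 2 ^ lev h = pos v %/ 2 ^ lev h.
  apply/eqP; rewrite eqn_leq leq_div2r ?(ltnW hv) //= eh leq_div2r //.
  by move: vh; clear; lia.
have bh' : pos v %/ 2 ^ lev h = pos h' %/ 2 ^ lev h.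
  apply/eqP; rewrite eqn_leq leq_div2r ?(ltnW vh') //= ev leq_div2r //.
  by move: h'v; clear; lia.
case elh : (lev h) => [|t].
  by move: eh; rewrite elh !expn0 !divn1; move: hv vh; clear; lia.
have lt : pos h' < (reach h).-1.
  apply: (separated_lt (seph _ elh) (seph' t _)); first by rewrite -elev.
  by rewrite -elh bv bh'.
have /negP[] := indH h h' hH h'H.
by rewrite /crosses; move: lt hv vh' hvh hh'v; clear; lia.
Qed.

Lemma nbrIE v (U : {set T}) :
  nbr v :&: U = [set a in U | crosses a v] :|: [set b in U | crosses v b].
Proof. by apply/setP => u; rewrite !inE; case: (u \in U); rewrite ?andbT ?andbF. Qed.

(** A trace of size at least 2 has two vertices on one side of [v], or exactly
    one on each side, and then it is an edge of [linking] at one of the [lam]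
    scales. *)
Lemma left_right_sparse (H U : {set T}) : independent H ->
  exists2 E : {set T * T}, #|E| <= (4 + 3 * lam) * #|U| &
    forall v, v \in H -> 1 < #|nbr v :&: U| -> hits E (nbr v :&: U).
Proof.
move=> indH; have [EL cardL hitL] := left_sparse U.
have [ER cardR hitR] := right_sparse U.
exists (EL :|: ER :|: \bigcup_(t in [set: 'I_lam]) linking H U t).
  apply: (@card_setU_sparse _ _ _ _ 4 (3 * lam)).
    exact: (@card_setU_sparse _ _ _ _ 2 2).
  apply: leq_trans (card_bigcup_le _ _) _.
  apply: (@leq_trans (\sum_(t in [set: 'I_lam]) 3 * #|U|)).
    by apply: leq_sum => t _; apply: linking_sparse.
  by rewrite sum_nat_const cardsT card_ord mulnCA mulnA.
move=> v vH; rewrite nbrIE.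
set A := [set a in U | _]; set B := [set a in U | _] => gt1.
have [le1A|/hitL] := leqP #|A| 1; last first.
  by apply: hitsS; rewrite ?subsetUl // -setUA subsetUl.
have [le1B|/hitR] := leqP #|B| 1; last first.
  by apply: hitsS; rewrite ?subsetUr //; apply: subset_trans (subsetUl _ _); apply: subsetUr.
have := leq_card_setU A B => le; move: gt1 => /leq_trans /(_ le) gt1.
have /cards1P[i Ai] : #|A| == 1 by move: le1A le1B gt1; clear; lia.
have /cards1P[j Bj] : #|B| == 1 by move: le1A le1B gt1; clear; lia.
have /setIdP[iU iv] : i \in A by rewrite Ai set11.
have /setIdP[jU vj] : j \in B by rewrite Bj set11.
have [iv' _ _] := and3P iv; have [vj' jv _] := and3P vj.
have [|t tl sep] := separated_exists (k := lam) vj'.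
  have /andP[_ rv] := pos_reach v; have /andP[pj rj] := pos_reach j.
  by rewrite !divn_small //; move: pj rj iv' vj' jv rv; clear; lia.
apply/exists_inP; exists (i, j) => /=.
  apply/setUP; right; apply/bigcupP; exists (Ordinal tl); first by rewrite inE.
  rewrite inE; apply/exists_inP; exists v => //.
  by rewrite /linked /= iv vj sep nbrIE -/A -/B Ai Bj eqxx.
rewrite Ai Bj !inE !eqxx orbT !andbT; apply: contraTneq vj' => <-.
by rewrite -leqNgt ltnW.
Qed.

(** The complement of [H] gets [M] colours that serve [H]; each of the
    [lam.+1] levels of [H] gets its own [M'] colours, which serve the vertices
    outside [H] that are dominated from that level. *)
Lemma conflict_free_model : 0 < lam -> exists c : T -> nat,
  (forall v, c v < 126 * lam ^ 2) /\
  forall v, nbr v != set0 -> unique_color (nbr v) c.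
Proof.
move=> lam0; have [lev levP] := level_exists.
have [H indH domH] := independent_dominating lev.
pose M := (8 * (4 + 3 * lam) + 2) * lam; pose M' := (8 * 4 + 2) * lam.
have [c [cM cuniq]] : colorable (fun h : {h | h \in H} => nbr (val h)) M (~: H).
  apply: colorable_of_sparse; last exact: leq_ltn_trans (max_card _) card_lam.
  move=> U _; have [E cardE hitE] := left_right_sparse U indH.
  by exists E => // -[h hH]; apply: hitE.
pose Hk k := [set h in H | lev h == k].
have /(@fin_all_exists _ (fun=> T -> nat))[c' c'P] (k : 'I_lam.+1) :
    exists c' : T -> nat, (forall v, v \in Hk k -> c' v < M') /\
     forall s : {v | lev v <= k}, nbr (val s) :&: Hk k != set0 ->
       unique_color (nbr (val s) :&: Hk k) c'.
  apply: (@colorable_of_sparse _ _ (fun s => nbr (val s)) 4); last first.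
    exact: leq_ltn_trans (max_card _) card_lam.
  move=> U /subsetP UH.
  have [EL cardL hitL] := left_sparse U; have [ER cardR hitR] := right_sparse U.
  exists (EL :|: ER); first exact: (@card_setU_sparse _ _ _ _ 2 2).
  move=> [v lev_v] /=; rewrite nbrIE.
  set A := [set a in U | _]; set B := [set a in U | _].
  have [->|[a /setIdP[aU av]]] := set_0Vmem A.
    by rewrite set0U => /hitR; apply: hitsS; rewrite // subsetUr.
  have [->|[b /setIdP[bU vb]]] := set_0Vmem B.
    by rewrite setU0 => /hitL; apply: hitsS; rewrite // subsetUl.
  have /setIdP[aH /eqP la] := UH _ aU; have /setIdP[bH /eqP lb] := UH _ bU.
  case: (one_sided levP indH aH bH _ _ av vb); first by rewrite la lb.
  by rewrite la.
pose k v : 'I_lam.+1 := inord (lev v).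
have kE v : k v = lev v :> nat by rewrite inordK // ltnS; case: (levP v).
have c'M v : v \in H -> c' (k v) v < M'.
  by move=> vH; have [+ _] := c'P (k v); apply; rewrite inE vH kE eqxx.
pose d v := if v \in H then M + (lev v * M' + c' (k v) v) else c v.
exists d; split=> v.
  rewrite /d; case: ifPn => vH.
    have [le _ _] := levP v; have := c'M v vH; move: le lam0.
    rewrite /M /M'; clear; nia.
  have := cM v; rewrite inE vH => /(_ isT) /leq_trans; apply.
  by rewrite /M; move: lam0; clear; nia.
move=> ne; have [vH|vH] := boolP (v \in H).
  have NH : nbr v :&: ~: H = nbr v.
    apply/setIidPl/subsetP => u; rewrite !inE; apply: contraL => uH.
    by rewrite negb_or !indH.
  have := cuniq (exist _ v vH); rewrite /= NH => /(_ ne)/exists_inP[u uN /forall_inP uuniq].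
  have notH w : w \in nbr v -> w \in H = false by rewrite -NH !inE => /andP[_ /negPf].
  apply/exists_inP; exists u => //; apply/forall_inP => w wN.
  by have := uuniq w wN; rewrite /d !notH.
have [u uH [uN lev_u]] := domH v vH.
have [_ c'uniq] := c'P (k u).
have lev_v : lev v <= k u by rewrite kE.
have := c'uniq (exist _ v lev_v); rewrite /= => /(_ _)/exists_inP[|x].
  by apply/set0Pn; exists u; rewrite in_setI uN inE uH kE eqxx.
case/setIP=> xN /setIdP[xH lx] /forall_inP xuniq; rewrite kE in lx.
have kx : k x = k u by apply: val_inj; rewrite /= !kE (eqP lx).
apply/exists_inP; exists x => //; apply/forall_inP => w wN; apply/implyP => wx.
rewrite /d xH; case: ifPn => wH; last first.
  by rewrite neq_ltn (leq_trans (cM w _)) ?inE // leq_addr.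
have := c'M x xH; have := c'M w wH.
have [lw|lw] := eqVneq (lev w) (lev u).
  have kw : k w = k u by apply: val_inj; rewrite /= !kE.
  rewrite kx kw (eqP lx) lw !eqn_add2l => _ _.
  by apply: (implyP (xuniq w _)) wx; rewrite in_setI wN inE wH kE lw eqxx.
rewrite (eqP lx); move: lw; clear; rewrite eqn_add2l => lw l1 l2.
apply: contra lw => /eqP e; apply/eqP.
have M0 : 0 < M' by apply: leq_ltn_trans l1.
have := congr1 (divn^~ M') e; rewrite !divnMDl // !divn_small //; lia.
Qed.
End Model.

(** * From the plane to the combinatorial model *)

From mathcomp Require Import all_order all_algebra.
From mathcomp Require Import all_classical all_reals all_analysis.
From mathcomp Require Import lra.

Import Order.TTheory GRing.Theory Num.Theory.

Local Open Scope classical_set_scope.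
Local Open Scope ring_scope.

Section Geometry.
Context {R : realType}.
Implicit Types (l : lshape R) (L : set (lshape R)).

Lemma points_meetP l l' : lx l < lx l' -> ltop l = ltop l' ->
  points l `&` points l' !=set0 <-> lx l' <= lright l /\ ly l' <= ly l.
Proof.
move=> xx tt; have := ly_lt_ltop l; have := ly_lt_ltop l'; have := lx_lt_lright l'.
move=> r' t' t; split.
  case=> -[a b] []; rewrite /points /vertical_segment /horizontal_segment /=.
  by move=> [[]|[]] /= + + [[]|[]] /=; rewrite ?in_itv /= => *; split; lra.
move=> [rl yy]; exists (lx l', ly l).
rewrite /points /vertical_segment /horizontal_segment /= !in_itv /=; split.
  by right; split=> //; lra.
by left; split=> //; lra.
Qed.

(** Two verticals with the same abscissa would share the part just below the
    grounding line. *)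
Lemma grounded_lx_inj L : nonoverlapping L -> grounded L ->
  forall l l', L l -> L l' -> lx l = lx l' -> l = l'.
Proof.
move=> nonov [g gP] l l' Ll Ll' xx; apply: contrapT => ne.
have tl : ltop l = g := gP l Ll; have tl' : ltop l' = g := gP l' Ll'.
have yl := ly_lt_ltop l; have yl' := ly_lt_ltop l'.
have inP y : Num.max (ly l) (ly l') <= y <= g -> (points l `&` points l') (lx l, y).
  rewrite ge_max => yP; split; left; split; rewrite /= ?in_itv //=; lra.
have lt : Num.max (ly l) (ly l') < g by rewrite gt_max; lra.
have top : (points l `&` points l') (lx l, g) by apply: inP; rewrite lexx ltW.
have low : (points l `&` points l') (lx l, Num.max (ly l) (ly l')).
  by apply: inP; rewrite lexx ltW.
have [e] := nonov _ _ Ll Ll' ne _ _ top low.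
by rewrite -e ltxx in lt.
Qed.

Lemma card_eq_enum n L : (L #= `I_n)%card ->
  exists2 f : 'I_n -> lshape R, injective f & forall l, L l <-> exists i, f i = l.
Proof.
rewrite card_eq_sym => /card_bijP[f [g fK gK]].
have mem (i : 'I_n) : val i \in `I_n by rewrite inE /=.
exists (fun i => val (f (SigSub (mem i)))).
  move=> i j /val_inj /(can_inj fK) /(congr1 val) /=; exact: val_inj.
move=> l; split=> [Ll|[i <-]]; last by apply: set_mem; apply: valP.
have lL : l \in L by rewrite inE.
have := valP (g (SigSub lL)); rewrite inE /= => lt.
exists (Ordinal lt); rewrite /= (_ : SigSub _ = g (SigSub lL)) ?gK //.
exact: val_inj.
Qed.

Lemma half_le_ln2 : 2^-1 <= ln (2 : R).
Proof.
have : ln (1 + - 2^-1 : R) <= - 2^-1 by apply: le_ln1Dx; lra.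
have -> : (1 + - 2^-1 : R) = 2^-1 by lra.
by rewrite lnV ?posrE // lerN2.
Qed.

Lemma trunc_log_le_ln n : (2 <= n)%N ->
  (trunc_log 2 n).+1%:R <= 4 * ln (n%:R : R).
Proof.
move=> n2; set k := trunc_log 2 n.
have k1 : (1 <= k)%N by rewrite /k trunc_log_gt0.
have : ln ((2 : R) ^+ k) <= ln (n%:R : R).
  rewrite ler_ln ?posrE ?exprn_gt0 // ?ltr0n; last by lia.
  by rewrite -natrX ler_nat trunc_logP //; lia.
rewrite lnXn // -[X in X <= _]mulr_natr => le.
have k1R : (1 : R) <= k%:R by rewrite ler1n.
have := ler_wpM2r (ler0n R k) half_le_ln2; rewrite -[k.+1%:R]natr1; lra.
Qed.

(** Meeting depends only on comparisons between coordinates, so it survives the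
    passage to ranks. The number [(trunc_log 2 n).+1] is the least exponent of a
    power of 2 greater than [n]. *)
Lemma conflict_free_coloring n L : (2 <= n)%N -> (L #= `I_n)%card ->
  nonoverlapping L -> grounded L ->
  exists col : lshape R -> 'I_(126 * (trunc_log 2 n).+1 ^ 2), conflict_free L col.
Proof.
move=> n2 /card_eq_enum[f f_inj fP] nonov gr.
have fL i : L (f i) by apply/fP; exists i.
have lx_inj i j : lx (f i) = lx (f j) -> i = j.
  by move=> e; apply: f_inj; apply: (grounded_lx_inj nonov gr).
have tops i j : ltop (f i) = ltop (f j).
  by have [g gP] := gr; have /= -> := gP _ (fL i); have /= -> := gP _ (fL j).
(* At equal ordinates a shape still meets the one on its right, so [below] ranks
   the latter as the lower one. *)
pose left (i j : 'I_n) := lx (f i) < lx (f j).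
pose below (i j : 'I_n) := (ly (f i) < ly (f j))
  || (ly (f i) == ly (f j)) && (lx (f j) < lx (f i)).
have left_total i j : i != j -> left i j || left j i.
  by move=> ij; rewrite /left -neq_lt; apply: contra ij => /eqP /lx_inj ->.
have left_irr : irreflexive left by move=> i; rewrite /left ltxx.
have left_trans : transitive left by move=> j i k; apply: lt_trans.
have below_total i j : i != j -> below i j || below j i.
  by move=> /left_total; rewrite /left /below; lra.
have below_irr : irreflexive below by move=> i; rewrite /below !ltxx andbF.
have below_trans : transitive below by move=> j i k; rewrite /below; lra.
pose pos := rank left; pose height := rank below.
pose reach i := #|[pred j | lx (f j) <= lright (f i)]|.
have pos_reach i j : (pos j < reach i)%N = (lx (f j) <= lright (f i)).
  apply/idP/idP => [|le].
    apply: contraTT; rewrite -ltNge -leqNgt => lt; apply/subset_leq_card/fintype.subsetP => k.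
    by rewrite !inE /left => /le_lt_trans; apply.
  apply/proper_card/properP; split; last by exists j; rewrite !inE // left_irr.
  by apply/fintype.subsetP => k; rewrite !inE /left => /ltW /le_trans; apply.
have crossesE i j : crosses pos reach height i j =
    [&& lx (f i) < lx (f j), lx (f j) <= lright (f i) & ly (f j) <= ly (f i)].
  rewrite /crosses pos_reach !ltn_rank // /left /below.
  by case: ltP => //= _; rewrite andbT orbC -le_eqVlt.
have nbrP i j : j \in nbr pos reach height i <-> neighbours L (f i) (f j).
  rewrite inE !crossesE /neighbours /=; split.
    case/orP=> /and3P[lt r y]; split=> //; split;
      try by move=> e; move: lt; rewrite e ltxx.
      by rewrite setIC; apply/points_meetP.
    by apply/points_meetP.
  case=> _ [ne meet].
  have /left_total : i != j by apply: contra_notN ne => /eqP ->.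
  case/orP=> lt; apply/orP; [right|left].
    by move/(points_meetP lt (tops _ _)): meet => [? ?]; apply/and3P.
  by move: meet; rewrite setIC => /(points_meetP lt (tops _ _))[? ?]; apply/and3P.
have [|||||c [cM cuniq]] :=
  @conflict_free_model _ pos reach height _ _ (trunc_log 2 n).+1.
- exact: rank_inj.
- exact: rank_inj.
- move=> i; rewrite pos_reach (ltW (lx_lt_lright _)) /=.
  apply: leq_trans (max_card _) _; rewrite card_ord ltnW // trunc_log_ltn //.
- by rewrite card_ord trunc_log_ltn.
- by [].
have M0 : (0 < 126 * (trunc_log 2 n).+1 ^ 2)%N by [].
pose col l := if [pick i | `[< f i = l >]] is Some i then Ordinal (cM i) else Ordinal M0.
have colE i : col (f i) = Ordinal (cM i).
  rewrite /col; case: pickP => [j /asboolP /f_inj -> //|/(_ i)].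
  by move/asboolPn.
exists col => _ /fP[i <-] [_ [/fP[j0 <-] nj0]].
have /cuniq/exists_inP[u uN /forall_inP uuniq] : nbr pos reach height i != finset.set0.
  by apply/set0Pn; exists j0; apply/nbrP; split.
exists (f u); first exact/nbrP.
move=> l lN; have [/fP[w wl] _] := lN; subst l => ne.
rewrite !colE => /(congr1 val) /= e.
have := uuniq w; rewrite e eqxx implybF negbK => /(_ _)/eqP wu.
by apply: ne; rewrite wu //; apply/nbrP.
Qed.
End Geometry.

Theorem theorem5 (R : realType) :
  exists K : R, forall (n : nat) (L : set (lshape R)),
    (2 <= n)%N -> (L #= `I_n)%card -> nonoverlapping L -> grounded L ->
    exists (m : nat) (col : lshape R -> 'I_m),
      m%:R <= K * ln (n%:R : R) ^+ 2 /\ conflict_free L col.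
Proof.
exists (126 * 4 ^+ 2) => n L n2 cardL nonov gr.
have [col colP] := conflict_free_coloring n2 cardL nonov gr.
exists (126 * (trunc_log 2 n).+1 ^ 2)%N, col; split=> //.
rewrite natrM natrX -mulrA -exprMn; apply: ler_wpM2l => //.
by rewrite lerXn2r ?nnegrE // ?(le_trans _ (trunc_log_le_ln n2)) // trunc_log_le_ln.
Qed.
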